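(* Let $\mathfrak t$ be a semibounded sesquilinear form in a complex Hilbert space $\mathfrak H$. Then the following statements are equivalent: (i) the Lebesgue decomposition of $\mathfrak t$ is the only Lebesgue type decomposition of the form $\mathfrak t$; (ii) the form $\mathfrak t_{\rm reg}$ is bounded.
   Context: A (sesquilinear) form $\mathfrak t$ in $\mathfrak H$ is a map $\operatorname{dom}\mathfrak t\times\operatorname{dom}\mathfrak t\to\mathbb C$, linear in the first and antilinear in the second entry, where $\operatorname{dom}\mathfrak t$ is a (not necessarily dense) linear subspace of $\mathfrak H$; $\mathfrak t[\varphi]=\mathfrak t[\varphi,\varphi]$. It is bounded if $|\mathfrak t[\varphi]|\le a\|\varphi\|^2$ on $\operatorname{dom}\mathfrak t$ for some $a\ge0$. It is semibounded if there is $c\in\mathbb R$ with $\mathfrak t[\varphi]\ge c\|\varphi\|^2$ on $\operatorname{dom}\mathfrak t$; the greatest such $c$ is the lower bound $m(\mathfrak t)\in\mathbb R$ (so $\operatorname{dom}\mathfrak t\ne\{0\}$ is understood). It is nonnegative if $\mathfrak t[\varphi]\ge0$ on $\operatorname{dom}\mathfrak t$. A semibounded form $\mathfrak t$ is closable if for every sequence $\varphi_n\in\operatorname{dom}\mathfrak t$ with $\varphi_n\to0$ in $\mathfrak H$ and $\mathfrak t[\varphi_n-\varphi_m]\to0$ one has $\mathfrak t[\varphi_n]\to0$. A nonnegative form $\mathfrak t$ is singular if for every $\varphi\in\operatorname{dom}\mathfrak t$ there is a sequence $\varphi_n\in\operatorname{dom}\mathfrak t$ with $\varphi_n\to\varphi$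 in $\mathfrak H$ and $\mathfrak t[\varphi_n]\to0$. A sum decomposition $\mathfrak t=\mathfrak t_1+\mathfrak t_2$ with $\operatorname{dom}\mathfrak t=\operatorname{dom}\mathfrak t_1=\operatorname{dom}\mathfrak t_2$ is a Lebesgue type decomposition of $\mathfrak t$ if $\mathfrak t_1$ is semibounded and closable, and $\mathfrak t_2$ is nonnegative and singular. The Lebesgue decomposition of $\mathfrak t$ is the Lebesgue type decomposition $\mathfrak t=\mathfrak t_{\rm reg}+\mathfrak t_{\rm sing}$ defined as follows. Choose $c\le m(\mathfrak t)$ and a linear operator $Q$ from $\mathfrak H$ to a Hilbert space $\mathfrak K$ with $\operatorname{dom}Q=\operatorname{dom}\mathfrak t$ and $\mathfrak t[\varphi,\psi]=c(\varphi,\psi)+(Q\varphi,Q\psi)$ (it always exists). Let $Q^{**}\subset\mathfrak H\times\mathfrak K$ be the closure of the graph of $Q$, $\operatorname{mul}Q^{**}=\{\omega:\{0,\omega\}\in Q^{**}\}$, and $P_0$ the orthogonal projection onto $\operatorname{mul}Q^{**}$. Then for $\varphi,\psi\in\operatorname{dom}\mathfrak t$, $$\mathfrak t_{\rm reg}[\varphi,\psi]=c(\varphi,\psi)+((I-P_0)Q\varphi,(I-P_0)Q\psi),\qquad\mathfrak t_{\rm sing}[\varphi,\psi]=(P_0Q\varphi,P_0Q\psi).$$ These forms do not depend on the choice of $c$ and $Q$; $\mathfrak t_{\rm reg}$ is the largest closable semibounded form below $\mathfrak t$. *)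

(* Defs.v *)
From HB Require Import structures.
From mathcomp Require Import all_boot all_order all_algebra.
From mathcomp Require Import complex.
From mathcomp Require Import all_classical all_reals all_analysis.

Set Implicit Arguments.
Unset Strict Implicit.
Unset Printing Implicit Defensive.

Import Order.TTheory GRing.Theory Num.Theory.
Import numFieldNormedType.Exports.

Local Open Scope classical_set_scope.
Local Open Scope ring_scope.
Local Open Scope complex_scope.

Record hilbertType (R : realType) := Hilbert {
  hilbert_sort :> completeNormedModType R[i];
  hdot : {dot hilbert_sort for Num.conj};
  hdot_norm : forall x : hilbert_sort, hdot x x = `|x| ^+ 2 }.

Section Subspace.
Variables (R : realType) (H : hilbertType R) (D : submodClosed H).

(* A linear subspace [D] of [H] as a vector space in its own right; the
   inclusion into [H] is [\val]. *)
Definition lsubspace := {x : H | x \in D}.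
HB.instance Definition _ := SubChoice.on lsubspace.
HB.instance Definition _ := [SubChoice_isSubLmodule of lsubspace by <:].

End Subspace.

Section Forms.
Variables (R : realType) (H : hilbertType R) (D : submodClosed H).
Implicit Types t : lsubspace D -> lsubspace D -> R[i].

Definition sesquilinear t : Prop :=
  (forall v, GRing.linear_for *%R (t ^~ v)) /\
  (forall u, GRing.linear_for (Num.conj \; *%R) (t u)).

(* In [R[i]], [x <= y] also asserts that [y - x] is real. *)
Definition lower_bounds t : set R :=
  [set c | forall u, c%:C * `|\val u| ^+ 2 <= t u u].

Definition semibounded t : Prop := exists c, lower_bounds t c.

(* This is the greatest lower bound when [t] is semibounded and [D] is
   not [{0}]. *)
Definition lower_bound t : R := sup (lower_bounds t).

Definition nonnegative t : Prop := forall u, 0 <= t u u.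

Definition form_bounded t : Prop :=
  exists2 a : R, 0 <= a & forall u, `|t u u| <= a%:C * `|\val u| ^+ 2.

(* [R[i]^o] is [R[i]] with the topology of its modulus. *)
Definition closable t : Prop :=
  forall u : nat -> lsubspace D,
    \val (u n) @[n --> \oo] --> (0 : H) ->
    (t (u p.1 - u p.2) (u p.1 - u p.2) : R[i]^o)
      @[p --> (\oo, \oo)] --> (0 : R[i]^o) ->
    (t (u n) (u n) : R[i]^o) @[n --> \oo] --> (0 : R[i]^o).

Definition singular t : Prop :=
  forall u : lsubspace D, exists un : nat -> lsubspace D,
    \val (un n) @[n --> \oo] --> (\val u : H) /\
    (t (un n) (un n) : R[i]^o) @[n --> \oo] --> (0 : R[i]^o).

Definition lebesgue_type_decomposition t t1 t2 : Prop :=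
  [/\ sesquilinear t1, sesquilinear t2,
      (forall u v, t u v = t1 u v + t2 u v),
      semibounded t1 /\ closable t1 & nonnegative t2 /\ singular t2].

End Forms.

Definition orth_proj (R : realType) (K : hilbertType R) (M : set K) (x : K)
    : K :=
  xget 0 [set y | M y /\ forall z, M z -> hdot K (x - y) z = 0].

Section LebesgueDecomposition.
Variables (R : realType) (H K : hilbertType R) (D : submodClosed H).
Variables (c : R) (Q : {linear lsubspace D -> K}).
Implicit Types u v : lsubspace D.

Definition represents (t : lsubspace D -> lsubspace D -> R[i]) : Prop :=
  forall u v, t u v = c%:C * hdot H (\val u) (\val v) + hdot K (Q u) (Q v).

(* The multivalued part of the closure of the graph of [Q] in [H * K]. *)
Definition mul_closure : set K :=
  [set w | closure (range (fun u => (\val u : H, Q u))) (0, w)].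

Let P0 : K -> K := orth_proj mul_closure.

Definition reg_form u v : R[i] :=
  c%:C * hdot H (\val u) (\val v) + hdot K (Q u - P0 (Q u)) (Q v - P0 (Q v)).

Definition sing_form u v : R[i] := hdot K (P0 (Q u)) (P0 (Q v)).

End LebesgueDecomposition.

(* Main.v *)
Require Import Defs.
From HB Require Import structures.
From mathcomp Require Import all_boot all_order all_algebra.
From mathcomp Require Import complex.
From mathcomp Require Import all_classical all_reals all_analysis.
From mathcomp Require Import lra ring.

(* Write [A = (I - P0) Q], so that [t_reg[u] = c |u|^2 + |A u|^2].

   If [t_reg] is bounded and [t = t1 + t2] is of Lebesgue type, then
   [s = t_reg - t1 = t2 - t_sing] is nonnegative by maximality of [t_reg]; it
   is bounded since [t1] is bounded below, and it lies below the singular form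
   [t2]. A bounded form below a singular one vanishes.

   If [t_reg] is unbounded, so is [A], and the uniform boundedness principle
   gives a vector [k], which may be taken small, such that
   [l u = (A u, k)] is an unbounded functional. Then [t_reg - |l|^2] is still
   comparable with [t_reg], hence closable, while [t_sing + |l|^2] is still
   singular: this is a second Lebesgue type decomposition. *)

Set Implicit Arguments.
Unset Strict Implicit.
Unset Printing Implicit Defensive.

Import Order.TTheory GRing.Theory Num.Theory.
Import numFieldNormedType.Exports.
Local Open Scope ring_scope.
Local Open Scope complex_scope.

(** * Real-valued norms and convergence *)

Section RealNorm.
Variables (R : realType).

(** Norms take values in [R[i]], whose order is only partial. The real part is the same number in
    [R], where infima and linear arithmetic are available. *)
Definition rnorm (V : normedZmodType R[i]) (x : V) : R := complex.Re `|x|.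

Lemma rnormE (V : normedZmodType R[i]) (x : V) : (rnorm x)%:C = `|x|.
Proof. by apply: RRe_real; exact: normr_real. Qed.

Lemma rnorm_ge0 (V : normedZmodType R[i]) (x : V) : 0 <= rnorm x.
Proof. by rewrite -ler0c rnormE. Qed.

Lemma rnorm0 (V : normedZmodType R[i]) : rnorm (0 : V) = 0.
Proof. by rewrite /rnorm normr0. Qed.

Lemma rnorm_eq0 (V : normedZmodType R[i]) (x : V) : rnorm x = 0 -> x = 0.
Proof. by move=> x0; apply/normr0_eq0; rewrite -rnormE x0. Qed.

Lemma rnormN (V : normedZmodType R[i]) (x : V) : rnorm (- x) = rnorm x.
Proof. by rewrite /rnorm normrN. Qed.

Lemma rnormC (V : normedZmodType R[i]) (x y : V) : rnorm (x - y) = rnorm (y - x).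
Proof. by rewrite /rnorm distrC. Qed.

Lemma rnormD (V : normedZmodType R[i]) (x y : V) :
  rnorm (x + y) <= rnorm x + rnorm y.
Proof. by rewrite -lecR rmorphD/= !rnormE ler_normD. Qed.

Lemma rnormB (V : normedZmodType R[i]) (x y : V) :
  rnorm (x - y) <= rnorm x + rnorm y.
Proof. by rewrite (le_trans (rnormD _ _))// rnormN. Qed.

Lemma rnorm_triangle (V : normedZmodType R[i]) (y x z : V) :
  rnorm (x - z) <= rnorm (x - y) + rnorm (y - z).
Proof. by rewrite (le_trans _ (rnormD _ _))// subrKA. Qed.

Lemma rnorm_dist (V : normedZmodType R[i]) (x y : V) :
  `|rnorm x - rnorm y| <= rnorm (x - y).
Proof.
have := rnormD (x - y) y; have := rnormD (y - x) x.
by rewrite !subrK (rnormC y x) ler_norml => ? ?; apply/andP; split; lra.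
Qed.

Lemma rnormZ (V : normedModType R[i]) (a : R[i]) (x : V) :
  rnorm (a *: x) = rnorm a * rnorm x.
Proof. by apply: complexI; rewrite rmorphM/= !rnormE normrZ. Qed.

Lemma rnormM (a b : R[i]) : rnorm (a * b) = rnorm a * rnorm b.
Proof. by apply: complexI; rewrite rmorphM/= !rnormE normrM. Qed.

Lemma rnormV (a : R[i]) : rnorm a^-1 = (rnorm a)^-1.
Proof. by apply: complexI; rewrite fmorphV/= !rnormE normfV. Qed.

Lemma rnorm_real (a : R) : rnorm (a%:C) = `|a|.
Proof.
apply: complexI; rewrite rnormE normc_def/=.
by rewrite expr0n/= addr0 sqrtr_sqr.
Qed.

Lemma ler_Re_rnorm (a : R[i]) : `|complex.Re a| <= rnorm a.
Proof. by rewrite -lecR rnormE normc_ge_Re. Qed.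

Lemma complex_ge (c : R) (a : R[i]) :
  (c%:C <= a) <-> (a = (complex.Re a)%:C /\ c <= complex.Re a).
Proof.
case: a => a b; rewrite lecE /=; split; first by move=> /andP[/eqP -> ?].
by case=> -[->] ?; rewrite eqxx.
Qed.

Section Topology.
Variable V : normedModType R[i].

Lemma nbhs_rnormP (x : V) (A : set V) :
  nbhs x A <-> exists2 e : R, 0 < e & forall y, rnorm (y - x) < e -> A y.
Proof.
split=> [/nbhs_ballP[e e0 eA]|[e e0 eA]].
  have [eE e0'] : e = (complex.Re e)%:C /\ 0 < complex.Re e.
    by move: e0; case: (e) => a b; rewrite /= ltcE/= => /andP[/eqP -> ?].
  exists (complex.Re e) => // y ye; apply: eA.
  by rewrite -ball_normE /ball_ /= distrC -rnormE eE ltcR.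
apply/nbhs_ballP; exists e%:C => [|y]; first by rewrite /= ltcR.
by rewrite -ball_normE /ball_ /= distrC -rnormE ltcR => /eA.
Qed.

Lemma cvg_rnormP (f : nat -> V) (x : V) :
  (f n @[n --> \oo] --> x)%classic <->
  forall e : R, 0 < e -> exists N, forall n, (N <= n)%N -> rnorm (f n - x) < e.
Proof.
split=> [fx e e0|fx].
  have /fx : nbhs x [set y | rnorm (y - x) < e]%classic.
    by apply/nbhs_rnormP; exists e.
  by case=> N _ NP; exists N.
move=> A /nbhs_rnormP[e /fx[N NP] eA].
by exists N => // n /= Nn; apply/eA/NP.
Qed.

Lemma cvg_rnorm2P (f : nat * nat -> V) (x : V) :
  (f p @[p --> (\oo, \oo)] --> x)%classic <->
  forall e : R, 0 < e -> exists N, forall m n, (N <= m)%N -> (N <= n)%N ->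
    rnorm (f (m, n) - x) < e.
Proof.
split=> [fx e e0|fx].
  have /fx : nbhs x [set y | rnorm (y - x) < e]%classic.
    by apply/nbhs_rnormP; exists e.
  case=> -[A B] /= [[M _ MA] [N _ NB]] AB; exists (maxn M N) => m n.
  rewrite !geq_max => /andP[Mm _] /andP[_ Nn].
  by apply: (AB (m, n)); split; [exact: MA|exact: NB].
move=> A /nbhs_rnormP[e /fx[N NP] eA].
exists ([set n | (N <= n)%N], [set n | (N <= n)%N])%classic.
  by split; exists N.
by case=> m n /= [Nm Nn]; apply/eA/NP.
Qed.

End Topology.

(** Completeness in epsilon form, as needed for minimizing sequences, the gliding hump and
    closability. *)
Lemma cauchy_rnormP (V : completeNormedModType R[i]) (f : nat -> V) :
  (forall e : R, 0 < e -> exists N, forall m n, (N <= m)%N -> (N <= n)%N ->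
    rnorm (f m - f n) < e) ->
  exists x, forall e : R, 0 < e -> exists N, forall n, (N <= n)%N ->
    rnorm (f n - x) < e.
Proof.
move=> fC; suff /cauchy_cvgP/cvg_ex[x /cvg_rnormP fx] :
    cauchy (f n @[n --> \oo])%classic by exists x.
apply/cauchy_exP => e e0.
have [eE e0'] : e = (complex.Re e)%:C /\ 0 < complex.Re e.
  by move: e0; case: (e) => a b; rewrite /= ltcE/= => /andP[/eqP -> ?].
have [N NP] := fC _ e0'; exists (f N); exists N => // n /= Nn.
by rewrite -ball_normE /ball_ /= -rnormE eE ltcR; exact: NP.
Qed.

End RealNorm.

(** * Algebra of the inner product *)

Section HilbertSpace.
Variables (R : realType) (K : hilbertType R).
Implicit Types (x y z : K).

Lemma hdotDl x y z : hdot K (x + y) z = hdot K x z + hdot K y z.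
Proof. by rewrite linearDl. Qed.
Lemma hdotDr x y z : hdot K z (x + y) = hdot K z x + hdot K z y.
Proof. by rewrite linearDr. Qed.
Lemma hdotBl x y z : hdot K (x - y) z = hdot K x z - hdot K y z.
Proof. by rewrite linearBl. Qed.
Lemma hdotBr x y z : hdot K z (x - y) = hdot K z x - hdot K z y.
Proof. by rewrite linearBr. Qed.
Lemma hdotZl a x y : hdot K (a *: x) y = a * hdot K x y.
Proof. by rewrite linearZl_LR. Qed.
Lemma hdotZr a x y : hdot K x (a *: y) = Num.conj a * hdot K x y.
Proof. by rewrite linearZr_LR. Qed.
Lemma hdotC x y : hdot K x y = Num.conj (hdot K y x).
Proof. by rewrite (hermC (hdot K)) expr0 mul1r. Qed.

Lemma hdotE x : hdot K x x = (rnorm x ^+ 2)%:C.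
Proof. by rewrite hdot_norm rmorphXn/= rnormE. Qed.

End HilbertSpace.

(** * Orthogonal projections *)

Section HilbertSpaceTheory.
Variables (R : realType) (K : hilbertType R).
Implicit Types (x y z : K).

Lemma mulr_conjE (a : R[i]) : a * Num.conj a = (rnorm a ^+ 2)%:C.
Proof. by rewrite -normCK rmorphXn/= rnormE. Qed.

Lemma conj_real (a : R) : Num.conj a%:C = a%:C.
Proof. exact: conjc_real. Qed.

(** Pythagoras after removing from [x] its component along [y]. It yields Cauchy-Schwarz and the
    orthogonality of the nearest point. *)
Lemma rnorm_deflate x y : y != 0 ->
  rnorm (x - (hdot K x y / (rnorm y ^+ 2)%:C) *: y) ^+ 2 =
  rnorm x ^+ 2 - rnorm (hdot K x y) ^+ 2 / rnorm y ^+ 2.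
Proof.
move=> y0; set N := rnorm y ^+ 2; set a := hdot K x y.
have N0 : N != 0.
  by apply: contra_neq y0 => /eqP; rewrite sqrf_eq0 => /eqP /rnorm_eq0.
apply: complexI; rewrite -hdotE !(hdotBl, hdotBr, hdotZl, hdotZr).
rewrite (hdotC y x) !hdotE -/N -/a; clearbody N.
have -> : Num.conj (a / N%:C) = Num.conj a / N%:C.
  by rewrite rmorphM/= fmorphV/= conj_real.
rewrite rmorphB/= (rmorphM (real_complex R) _ N^-1)/= fmorphV/= -mulr_conjE.
have NC : N%:C != 0 by rewrite fmorph_eq0.
by field.
Qed.

Lemma cauchy_schwarz x y : rnorm (hdot K x y) <= rnorm x * rnorm y.
Proof.
have [->|y0] := eqVneq y 0; first by rewrite linear0r !rnorm0 mulr0.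
have y0' : 0 < rnorm y.
  by rewrite lt_neqAle rnorm_ge0 andbT eq_sym; apply: contra_neq y0 => /rnorm_eq0.
have := sqr_ge0 (rnorm (x - (hdot K x y / (rnorm y ^+ 2)%:C) *: y)).
rewrite rnorm_deflate// subr_ge0 ler_pdivrMr ?exprn_gt0// -exprMn.
by rewrite ler_sqr// nnegrE ?mulr_ge0// rnorm_ge0.
Qed.

Lemma parallelogram x y :
  rnorm (x + y) ^+ 2 + rnorm (x - y) ^+ 2 = 2 * rnorm x ^+ 2 + 2 * rnorm y ^+ 2.
Proof.
rewrite !mulr_natl !mulr2n; apply: complexI; rewrite !rmorphD/= -!hdotE.
by rewrite !(hdotBl, hdotBr, hdotDl, hdotDr); ring.
Qed.

Lemma eventually_invn_lt (e : R) : 0 < e ->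
  exists N, forall n, (N <= n)%N -> n.+1%:R^-1 < e.
Proof.
move=> e0; exists (Num.truncn e^-1) => n Nn.
rewrite invf_plt ?posrE ?ltr0n//.
rewrite (lt_le_trans (truncnS_gt _))// ler_nat; exact: leq_ltn_trans Nn _.
Qed.

Section OrthogonalProjection.
Variable M : set K.
Hypothesis M0 : M 0.
Hypothesis MP : forall a y z, M y -> M z -> M (a *: y + z).
Hypothesis M_closed :
  forall x, (forall e : R, 0 < e -> exists2 y, M y & rnorm (y - x) < e) -> M x.

(** A minimizing sequence for the distance from [x] to [M] is Cauchy by the parallelogram law, and
    its limit is a nearest point. Minimality then forces orthogonality. *)
Lemma orth_proj_exists x : exists y, M y /\ forall z, M z -> hdot K (x - y) z = 0.
Proof.
pose E := [set r | exists2 z, M z & r = rnorm (x - z) ^+ 2]%classic.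
have infE : has_inf E.
  split; first by exists (rnorm (x - 0) ^+ 2), 0.
  by exists 0 => _ [z _ ->]; exact: sqr_ge0.
pose d := inf E.
have dE z : M z -> d <= rnorm (x - z) ^+ 2.
  by move=> Mz; apply: ge_inf; [case: infE|exists z].
have /choice[z zP] : forall n : nat, exists z, M z /\ rnorm (x - z) ^+ 2 < d + n.+1%:R^-1.
  move=> n; have n0 : 0 < n.+1%:R^-1 :> R by rewrite invr_gt0.
  by have [_ [z Mz ->] ?] := inf_adherent n0 infE; exists z.
have [y zy] : exists y, forall e : R, 0 < e -> exists N, forall n, (N <= n)%N ->
    rnorm (z n - y) < e.
  apply: cauchy_rnormP => e e0.
  (* The midpoint lies in [M], so its squared distance is at least [d]; the parallelogram law then
     bounds the squared gap by four times the excess over [d]. *)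
  have e40 : 0 < e ^+ 2 / 4 by rewrite divr_gt0// exprn_gt0.
  have [N NP] := eventually_invn_lt e40; exists N => m n Nm Nn.
  rewrite -ltr_sqr ?nnegrE ?rnorm_ge0 ?(ltW e0)//.
  have [Mm zm] := zP m; have [Mn zn] := zP n.
  have /dE : M (2^-1 *: (z m + z n)).
    by rewrite -[_ *: _]addr0; apply: MP M0; rewrite -[z m]scale1r; exact: MP.
  have := parallelogram (x - z m) (x - z n).
  have -> : x - z m - (x - z n) = z n - z m by rewrite opprB addrC addrA subrK.
  have -> : x - z m + (x - z n) = 2 *: (x - 2^-1 *: (z m + z n)).
    rewrite scalerBr scalerA divff// scale1r scaler_nat mulr2n opprD.
    by rewrite addrACA.
  rewrite rnormZ (_ : rnorm 2 = 2); last first.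
    by rewrite -(rmorph_nat (real_complex R)) rnorm_real ger0_norm.
  rewrite exprMn (rnormC (z n)).
  have := NP _ Nm; have := NP _ Nn; move: zm zn.
  move: (rnorm (x - z m) ^+ 2) (rnorm (x - z n) ^+ 2) (m.+1%:R^-1) (n.+1%:R^-1).
  move: (rnorm (z m - z n) ^+ 2) (e ^+ 2) (rnorm _ ^+ 2) => a b c f g h k.
  by lra.
have My : M y.
  by apply: M_closed => e /zy[N /(_ _ (leqnn N)) ?]; exists (z N) => //; case: (zP N).
have ymin w : M w -> rnorm (x - y) <= rnorm (x - w).
  move=> Mw; apply/ler_addgt0Pr => e e0.
  have e20 : 0 < e / 2 by rewrite divr_gt0.
  have [N1 N1P] := zy _ e20.
  (* The tolerance is [(e / 2) ^+ 2] because [zP] controls squared distances. *)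
  have [N2 N2P] := eventually_invn_lt (exprn_gt0 2 e20).
  pose n := maxn N1 N2.
  have := N1P n (leq_maxl _ _); have := N2P n (leq_maxr _ _).
  have [_ zn] := zP n; move: (dE _ Mw) => dw n2 n1.
  have : rnorm (x - z n) <= rnorm (x - w) + e / 2.
    rewrite -ler_sqr ?nnegrE ?addr_ge0 ?rnorm_ge0 ?(ltW e20)//.
    have : 0 <= rnorm (x - w) * (e / 2) by rewrite mulr_ge0 ?rnorm_ge0// ltW.
    by rewrite sqrrD -mulr_natr; move: dw zn n2; move: (n.+1%:R^-1) => ?; lra.
  by have := rnorm_triangle (z n) x y; lra.
exists y; split=> // w Mw; have [->|w0] := eqVneq w 0; first by rewrite linear0r.
have w0' : 0 < rnorm w ^+ 2.
  rewrite exprn_gt0// lt_neqAle rnorm_ge0 andbT eq_sym.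
  by apply: contra_neq w0 => /rnorm_eq0.
have := rnorm_deflate (x - y) w0; set a := _ / _.
(* The competitor moves [y] by the component of [x - y] along [w]; by minimality the decrease in
   [rnorm_deflate] must vanish. *)
have /ymin : M (a *: w + y) by exact: MP.
rewrite -ler_sqr ?nnegrE ?rnorm_ge0// opprD addrCA addrC.
move=> /[swap] ->; rewrite lerBrDl gerDr.
rewrite pmulr_lle0 ?invr_gt0// => a0; apply: rnorm_eq0; apply/eqP.
by rewrite -sqrf_eq0 eq_le a0 sqr_ge0.
Qed.

Local Notation P := (orth_proj M).

Lemma orth_projP x : M (P x) /\ forall z, M z -> hdot K (x - P x) z = 0.
Proof.
exact: (@xgetPex _ 0 [set y | M y /\ forall z, M z -> hdot K (x - y) z = 0]%classic
         (orth_proj_exists x)).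
Qed.

Lemma orth_proj_mem x : M (P x). Proof. by case: (orth_projP x). Qed.

Lemma orth_proj_orth x z : M z -> hdot K (x - P x) z = 0.
Proof. by case: (orth_projP x) => _; exact. Qed.

Lemma orth_proj_orthr x z : M z -> hdot K z (x - P x) = 0.
Proof. by move=> ?; rewrite hdotC orth_proj_orth ?rmorph0. Qed.

(** Two candidates differ by a vector of [M] that is orthogonal to [M], hence to itself. *)
Lemma orth_proj_uniq x y : M y -> (forall z, M z -> hdot K (x - y) z = 0) -> P x = y.
Proof.
move=> My yP; apply/eqP; rewrite -subr_eq0; apply/eqP.
have MPy : M (P x - y) by rewrite addrC -scaleN1r; apply: MP => //; exact: orth_proj_mem.
apply: rnorm_eq0; apply/eqP; rewrite -sqrf_eq0 -(inj_eq (@complexI R)) -hdotE.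
rewrite -{1}(subrKA x) hdotDl -[P x - x]opprB linearNl/=.
by rewrite orth_proj_orth// yP// oppr0 addr0.
Qed.

Lemma orth_projD_scale a x y : P (a *: x + y) = a *: P x + P y.
Proof.
apply: orth_proj_uniq; first by apply: MP; exact: orth_proj_mem.
move=> z Mz; rewrite opprD addrACA -scalerBr hdotDl hdotZl.
by rewrite !orth_proj_orth// mulr0 addr0.
Qed.

Lemma orth_proj_id x : M x -> P x = x.
Proof. by move=> Mx; apply: orth_proj_uniq => // z _; rewrite subrr linear0l. Qed.

Lemma hdot_orth_proj x y :
  hdot K x y = hdot K (P x) (P y) + hdot K (x - P x) (y - P y).
Proof.
rewrite -{1}(subrK (P x) x) -{1}(subrK (P y) y) (hdotDl (x - P x)).
rewrite !(hdotDr (y - P y)).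
rewrite (orth_proj_orth x (orth_proj_mem y)) (orth_proj_orthr y (orth_proj_mem x)).
by rewrite addr0 add0r addrC.
Qed.

Lemma rnorm_orth_proj x : rnorm x ^+ 2 = rnorm (P x) ^+ 2 + rnorm (x - P x) ^+ 2.
Proof.
by apply: complexI; rewrite rmorphD/= -!hdotE hdot_orth_proj.
Qed.

Lemma rnorm_orth_proj_le x : rnorm (P x) <= rnorm x.
Proof.
rewrite -ler_sqr ?nnegrE ?rnorm_ge0// [leRHS]rnorm_orth_proj.
by rewrite lerDl sqr_ge0.
Qed.

Lemma rnorm_orth_compl_le x : rnorm (x - P x) <= rnorm x.
Proof.
rewrite -ler_sqr ?nnegrE ?rnorm_ge0// [leRHS]rnorm_orth_proj.
by rewrite lerDr sqr_ge0.
Qed.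

End OrthogonalProjection.

End HilbertSpaceTheory.

(** * Unbounded families of functionals, and the parts of an operator *)

Section GlidingHump.
Variables (R : realType) (K : hilbertType R).

(* [k] is the limit of [ks n], where [ks n.+1 = ks n + d n] or [ks n - d n] with
   [rnorm (d n) = 3 ^- n] and the sign chosen so that the pairing of [x n] with
   [ks n.+1] is at least [3 ^- n * rnorm (x n)]; the later steps change [k] by at
   most half of [3 ^- n]. *)
Lemma exists_dot_unbounded (x : nat -> K) :
  (forall n, 2 * n%:R * 3 ^+ n <= rnorm (x n)) ->
  exists k, forall n, n%:R <= rnorm (hdot K (x n) k).
Proof.
move=> xlarge; pose g n : R := 3 ^- n; pose r n := rnorm (x n).
have g_gt0 n : 0 < g n by rewrite invr_gt0 exprn_gt0.
have gS n : g n = 3 * g n.+1.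
  by rewrite /g exprS invfM mulrA divff// mul1r.
(* If [r n] vanishes, which the hypothesis allows only for [n = 0], division by zero makes [d n]
   equal to [0]. *)
pose d n : K := (g n / r n)%:C *: x n.
have dle n : rnorm (d n) <= g n.
  rewrite rnormZ rnorm_real ger0_norm ?divr_ge0 ?rnorm_ge0 ?(ltW (g_gt0 _))//.
  have [r0|r0] := eqVneq (r n) 0; first by rewrite -/(r n) r0 mulr0 ltW.
  by rewrite -mulrA mulVf// mulr1.
have hd n : rnorm (hdot K (x n) (d n)) = g n * r n.
  rewrite hdotZr hdotE conj_real -rmorphM/= rnorm_real -/(r n).
  have [->|r0] := eqVneq (r n) 0; first by rewrite expr0n !mulr0 normr0.
  rewrite expr2 mulrA divfK// ger0_norm// mulr_ge0 ?(ltW (g_gt0 _))//.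
  exact: rnorm_ge0.
pose ks := fix F n : K := if n is m.+1 then
  if rnorm (hdot K (x m) (d m)) <= rnorm (hdot K (x m) (F m + d m))
  then F m + d m else F m - d m else 0.
have ks_step n : rnorm (ks n.+1 - ks n) <= g n.
  rewrite /=; case: ifP => _; first by rewrite addrC addKr.
  by rewrite addrC addKr rnormN.
have ks_large n : g n * r n <= rnorm (hdot K (x n) (ks n.+1)).
  rewrite -hd /=; case: ifPn => //; rewrite -ltNge hdotDr hdotBr.
  move: (hdot K _ (ks n)) (hdot K _ (d n)) => a b ab.
  (* The two candidates differ by [2 * b], so when the plus sign falls short of [rnorm b] the minus
     sign reaches it. *)
  have := rnormB (a + b) (a - b).
  rewrite (_ : a + b - (a - b) = 2 * b); last by ring.
  by rewrite rnormM -(rmorph_nat (real_complex R)) rnorm_real ger0_norm//; lra.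
(* The bound is the geometric sum of the steps [g n], ..., [g (n + j - 1)]. *)
have ks_tail n j : rnorm (ks (n + j)%N - ks n) <= 3 / 2 * (g n - g (n + j)%N).
  elim: j => [|j IH]; first by rewrite addn0 !subrr rnorm0 mulr0.
  have := rnorm_triangle (ks (n + j)%N) (ks (n + j).+1) (ks n).
  by rewrite addnS; have := ks_step (n + j)%N; have := gS (n + j)%N; lra.
have ks_tail' n m : (n <= m)%N -> rnorm (ks m - ks n) <= 3 / 2 * g n.
  move=> /subnKC <-; apply: le_trans (ks_tail _ _) _.
  by have := g_gt0 (n + (m - n))%N; lra.
have [k kP] : exists k, forall e : R, 0 < e -> exists N, forall n, (N <= n)%N ->
    rnorm (ks n - k) < e.
  apply: cauchy_rnormP => e e0.
  have e30 : 0 < e / 3 by rewrite divr_gt0.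
  have [N NP] := eventually_invn_lt e30; exists N => m n Nm Nn.
  have gN : g N < e / 3.
    apply: le_lt_trans (NP N (leqnn _)).
    rewrite /g lef_pV2 ?posrE ?ltr0n ?exprn_gt0// -natrX ler_nat.
    exact: ltn_expl.
  have := rnorm_triangle (ks N) (ks m) (ks n).
  have := ks_tail' _ _ Nm; have := ks_tail' _ _ Nn.
  by rewrite (rnormC (ks n)); lra.
exists k => n.
have kn : rnorm (ks n.+1 - k) <= 3 / 2 * g n.+1.
  apply/ler_addgt0Pr => e /kP[N NP].
  have := rnorm_triangle (ks (maxn N n.+1)) (ks n.+1) k.
  have := NP _ (leq_maxl N n.+1); have := ks_tail' _ _ (leq_maxr N n.+1).
  by rewrite (rnormC (ks n.+1) (ks (maxn _ _))); lra.
have := rnormD (hdot K (x n) (ks n.+1 - k)) (hdot K (x n) k).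
rewrite -hdotDr subrK.
have := cauchy_schwarz (x n) (ks n.+1 - k); rewrite -/(r n).
have : r n * rnorm (ks n.+1 - k) <= r n * (3 / 2 * g n.+1).
  by rewrite ler_wpM2l// rnorm_ge0.
(* Since [3 / 2 * g n.+1] is half of [g n], at least half of [g n * r n] survives in the limit; the
   factor 2 pays for this. *)
have gr : 2 * n%:R <= g n * r n.
  by rewrite /g [leRHS]mulrC ler_pdivlMr ?exprn_gt0.
by have := ks_large n; move: gr; rewrite (gS n); nra.
Qed.

End GlidingHump.

(** * The regular and the singular part of an operator *)

Section RegularPart.
Variables (R : realType) (H K : hilbertType R) (D : submodClosed H).
Variable Q : {linear lsubspace D -> K}.
Implicit Types u v w : lsubspace D.

Lemma mul_closureP k : mul_closure Q k <->
  forall e : R, 0 < e -> exists2 w, rnorm (\val w) < e & rnorm (Q w - k) < e.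
Proof.
split=> [clk e e0|kP A].
  have /clk[_ [[w _ <-]]] : nbhs ((0 : H), k)
      ([set y | rnorm (y - 0) < e] `*` [set y | rnorm (y - k) < e])%classic.
    exists ([set y | rnorm (y - 0) < e], [set y | rnorm (y - k) < e])%classic => //.
    by split; apply/nbhs_rnormP; exists e.
  by case=> /= we Qwe; exists w => //; rewrite subr0 in we.
case=> -[A1 A2] /= [/nbhs_rnormP[e1 e10 eA1] /nbhs_rnormP[e2 e20 eA2]] AA.
have [|w] := kP (Num.min e1 e2); first by rewrite lt_min e10.
rewrite !lt_min => /andP[w1 _] /andP[_ w2].
exists (\val w, Q w); split; first by exists w.
by apply: AA; split; [apply: eA1; rewrite subr0|apply: eA2].
Qed.

Lemma mul_closure0 : mul_closure Q 0.
Proof.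
apply/mul_closureP => e e0; exists 0; first by rewrite linear0 rnorm0.
by rewrite linear0 subr0 rnorm0.
Qed.

Lemma mul_closureDZ a k l :
  mul_closure Q k -> mul_closure Q l -> mul_closure Q (a *: k + l).
Proof.
move=> /mul_closureP Mk /mul_closureP Ml; apply/mul_closureP => e e0.
have a0 : 0 < rnorm a + 1 by rewrite ltr_wpDl ?rnorm_ge0.
have [|w w1 w2] := Mk (e / 2 / (rnorm a + 1)); first by rewrite !divr_gt0.
have [|v v1 v2] := Ml (e / 2); first by rewrite !divr_gt0.
have aux (V : normedModType R[i]) (y : V) :
    rnorm y < e / 2 / (rnorm a + 1) -> rnorm (a *: y) < e / 2.
  rewrite ltr_pdivlMr// mulrC rnormZ; apply: le_lt_trans.
  by rewrite ler_wpM2r ?rnorm_ge0// lerDl.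
exists (a *: w + v).
  rewrite linearD linearZ/= (le_lt_trans (rnormD _ _))//.
  by have := aux _ _ w1; lra.
rewrite linearD linearZ/= opprD addrACA -scalerBr (le_lt_trans (rnormD _ _))//.
by have := aux _ _ w2; lra.
Qed.

Lemma mul_closure_closed k :
  (forall e : R, 0 < e -> exists2 l, mul_closure Q l & rnorm (l - k) < e) ->
  mul_closure Q k.
Proof.
move=> kP; apply/mul_closureP => e e0; have e20 : 0 < e / 2 by rewrite divr_gt0.
have [l /mul_closureP/(_ _ e20)[w w1 w2] lk] := kP _ e20; exists w; first by lra.
by have := rnorm_triangle l (Q w) k; lra.
Qed.

(** These are [P0 Q] and [A = (I - P0) Q]. As linear maps they turn the two forms into pullbacks of
    inner products. *)
Definition sing_part u : K := orth_proj (mul_closure Q) (Q u).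
Definition reg_part u : K := Q u - sing_part u.

Lemma sing_part_mem u : mul_closure Q (sing_part u).
Proof. exact: (orth_proj_mem mul_closure0 mul_closureDZ mul_closure_closed). Qed.

Arguments sing_part_mem : clear implicits.

Lemma reg_part_orth u k : mul_closure Q k -> hdot K (reg_part u) k = 0.
Proof. exact: (orth_proj_orth mul_closure0 mul_closureDZ mul_closure_closed). Qed.

Lemma sing_part_linear : linear sing_part.
Proof.
move=> a u v; rewrite /sing_part linearP.
by rewrite (orth_projD_scale mul_closure0 mul_closureDZ mul_closure_closed).
Qed.

Lemma reg_part_linear : linear reg_part.
Proof.
move=> a u v; rewrite /reg_part sing_part_linear linearP.
by rewrite opprD addrACA -scalerBr.
Qed.

HB.instance Definition _ := GRing.isLinear.Build _ _ _ _ sing_part sing_part_linear.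
HB.instance Definition _ := GRing.isLinear.Build _ _ _ _ reg_part reg_part_linear.

Lemma hdot_parts u v : hdot K (Q u) (Q v) =
  hdot K (reg_part u) (reg_part v) + hdot K (sing_part u) (sing_part v).
Proof.
rewrite addrC.
exact: (hdot_orth_proj mul_closure0 mul_closureDZ mul_closure_closed).
Qed.

(** Since [P0 (Q u)] lies in the multivalued part, an arbitrarily small [w] can carry almost exactly
    the singular part of [u]. All later approximations rest on this. *)
Lemma sing_part_approx u (e : R) : 0 < e ->
  exists2 w, rnorm (\val w) < e & rnorm (Q w - sing_part u) < e.
Proof. by move: e; apply/mul_closureP; exact: sing_part_mem. Qed.

(** The projection fixes [sing_part u] and is a contraction. *)
Lemma sing_part_dist w u : rnorm (sing_part w - sing_part u) <= rnorm (Q w - sing_part u).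
Proof.
have <- : orth_proj (mul_closure Q) (Q w - sing_part u) = sing_part w - sing_part u.
  rewrite addrC -scaleN1r.
  rewrite (orth_projD_scale mul_closure0 mul_closureDZ mul_closure_closed).
  rewrite (orth_proj_id mul_closure0 mul_closureDZ mul_closure_closed (sing_part_mem u)).
  by rewrite scaleN1r addrC.
exact: (rnorm_orth_proj_le mul_closure0 mul_closureDZ mul_closure_closed).
Qed.

(** The complementary projection kills [sing_part u] and is a contraction. *)
Lemma reg_part_dist w u : rnorm (reg_part w) <= rnorm (Q w - sing_part u).
Proof.
have <- : (Q w - sing_part u) - orth_proj (mul_closure Q) (Q w - sing_part u) = reg_part w.
  rewrite [X in orth_proj _ X]addrC -scaleN1r.
  rewrite (orth_projD_scale mul_closure0 mul_closureDZ mul_closure_closed).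
  rewrite (orth_proj_id mul_closure0 mul_closureDZ mul_closure_closed (sing_part_mem u)).
  by rewrite scaleN1r opprD opprK addrA subrK.
exact: (rnorm_orth_compl_le mul_closure0 mul_closureDZ mul_closure_closed).
Qed.

(** Subtracting from [u n] a small vector with the same singular part, up to a small error, shows
    that [k] lies in [mul_closure Q]. Regular parts are orthogonal to that space, so their limit [k]
    is orthogonal to itself. *)
Lemma reg_part_closable (u : nat -> lsubspace D) k :
  (forall e : R, 0 < e -> exists N, forall n, (N <= n)%N -> rnorm (\val (u n)) < e) ->
  (forall e : R, 0 < e -> exists N, forall n, (N <= n)%N ->
    rnorm (reg_part (u n) - k) < e) ->
  k = 0.
Proof.
move=> u0 uk.
have both (e : R) : 0 < e ->
    exists n, rnorm (\val (u n)) < e /\ rnorm (reg_part (u n) - k) < e.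
  move=> e0; have [N NP] := u0 _ e0; have [M MP] := uk _ e0.
  by exists (maxn N M); split; [apply: NP; exact: leq_maxl|apply: MP; exact: leq_maxr].
have Mk : mul_closure Q k.
  apply/mul_closureP => e e0; have e20 : 0 < e / 2 by rewrite divr_gt0.
  have [n [n1 n2]] := both _ e20.
  have [w w1 w2] := sing_part_approx (u n) e20.
  exists (u n - w).
    rewrite linearB/= (le_lt_trans (rnormB _ _))//; lra.
  rewrite linearB/= (_ : _ - k = reg_part (u n) - k - (Q w - sing_part (u n))).
    by rewrite (le_lt_trans (rnormB _ _))//; lra.
  by rewrite /reg_part opprB [LHS]addrAC [Q _ - _ - k]addrAC addrA subrK.
apply: rnorm_eq0; apply/eqP; rewrite eq_le rnorm_ge0 andbT.
apply/ler_addgt0Pr => e /both[n [_ nk]]; rewrite add0r.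
have := cauchy_schwarz (k - reg_part (u n)) k.
rewrite hdotBl (reg_part_orth _ Mk) subr0 hdotE rnorm_real ger0_norm ?sqr_ge0//.
rewrite rnormC expr2 => kk; have [->|k0] := eqVneq (rnorm k) 0.
  by apply: ltW; apply: le_lt_trans nk; exact: rnorm_ge0.
apply: ltW; apply: le_lt_trans nk; rewrite -(ler_pM2r (_ : 0 < rnorm k))//.
by rewrite lt_neqAle eq_sym k0 rnorm_ge0.
Qed.

End RegularPart.

(** * Forms and maximality of the regular part *)

(** Used with [x] and [y] the squared norms of [v] and [Q v]: a form between a lower bound and [t]
    is small when both are. *)
Lemma ltr_norm_between (F : realFieldType) (c1 c x y r f : F) :
  0 <= x -> x < f -> y < f -> c1 * x <= r -> r <= c * x + y ->
  `|r| < (`|c1| + `|c| + 1) * f.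
Proof.
move=> x0 xf yf c1r rc; have f0 := le_lt_trans x0 xf.
have := ler_norm c; have := ler_norm (- c1); rewrite normrN.
have := normr_ge0 c; have := normr_ge0 c1.
move: `|c| `|c1| => C C1 C10 C0 c1C cC; rewrite ltr_norml.
have := mulr_ge0 C0 (ltW f0); have := mulr_ge0 C10 (ltW f0).
have := ler_wpM2l C0 (ltW xf); have := ler_wpM2l C10 (ltW xf).
have := ler_wpM2r x0 c1C; have := ler_wpM2r x0 cC.
by move=> *; apply/andP; split; lra.
Qed.

Section SesquilinearForms.
Variables (R : realType) (H : hilbertType R) (D : submodClosed H).
Implicit Types (s t : lsubspace D -> lsubspace D -> R[i]) (u v w : lsubspace D).

Lemma ReD (a b : R[i]) : complex.Re (a + b) = complex.Re a + complex.Re b.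
Proof. by case: a; case: b. Qed.

Lemma ReN (a : R[i]) : complex.Re (- a) = - complex.Re a.
Proof. by case: a. Qed.

Lemma ReZ (r : R) (a : R[i]) : complex.Re (r%:C * a) = r * complex.Re a.
Proof. by case: a => a b /=; rewrite mul0r subr0. Qed.

Lemma Re_ge0 (a : R[i]) : 0 <= a -> 0 <= complex.Re a.
Proof. by case: a => a b; rewrite lecE => /andP[]. Qed.

Lemma ge0_ReE (a : R[i]) : 0 <= a -> a = (complex.Re a)%:C.
Proof. by move=> a0; rewrite RRe_real// ger0_real. Qed.

Lemma sesq_expand s a u v : sesquilinear s ->
  s (a *: u + v) (a *: u + v) =
  a * Num.conj a * s u u + (a * s u v + Num.conj a * s v u) + s v v.
Proof.
move=> [sl sr]; rewrite [LHS](sl (a *: u + v) a u v).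
rewrite [s u _](sr u a u v) [s v _](sr v a u v) /=.
by ring.
Qed.

(** Polarization: the expansion with [a = 1] gives [s u v + s v u = 0], and with [a = i] it gives
    [s u v = s v u]. *)
Lemma sesq_diag0 s : sesquilinear s -> (forall u, s u u = 0) -> forall u v, s u v = 0.
Proof.
move=> ss s0 u v.
have := sesq_expand 1 u v ss; have := sesq_expand 'i%C u v ss.
rewrite !s0 !(mulr0, add0r, addr0) rmorph1 !mul1r.
have -> : Num.conj 'i%C = - 'i%C :> R[i] by apply/eqP; rewrite eq_complex/= oppr0 !eqxx.
rewrite mulNr -mulrBr => /esym/eqP.
rewrite mulf_eq0 eq_complex/= oner_eq0 andbF/= subr_eq0 => /eqP -> /esym/eqP.
by rewrite -mulr2n mulrn_eq0/= => /eqP.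
Qed.

(** Nonnegativity at [- e *: u + v] bounds the cross terms. As [e] tends to 0 the weight of [s u u]
    tends to 1, at the cost of a large weight on [s v v]. *)
Lemma sesq_young s u v (e : R) : sesquilinear s -> (forall u, 0 <= s u u) -> 0 < e ->
  complex.Re (s (u + v) (u + v)) <=
  (1 + e) * complex.Re (s u u) + (1 + e^-1) * complex.Re (s v v).
Proof.
move=> ss s0 e0; have := sesq_expand 1 u v ss.
rewrite rmorph1 scale1r !mul1r => ->; rewrite !ReD.
have /Re_ge0 := s0 ((- e)%:C *: u + v).
rewrite sesq_expand// conj_real -mulrA -mulrDr !ReD !ReZ ReD.
move: (complex.Re _) (complex.Re _) (complex.Re _) (complex.Re _) => d c b a.
rewrite mulrA mulrNN mulNr => H0.
have : b + c <= e * a + e^-1 * d; last by lra.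
rewrite -(ler_pM2l e0) !mulrDr (mulrA e e^-1) divff ?gt_eqF// mul1r.
by lra.
Qed.

Lemma sesq_hdot (K : hilbertType R) (F : {linear lsubspace D -> K}) :
  sesquilinear (fun u v => hdot K (F u) (F v)).
Proof.
by split=> w a u v; rewrite linearP/= (hdotDl, hdotDr) (hdotZl, hdotZr).
Qed.

Lemma sesq_rank1 (l : lsubspace D -> R[i]) :
  (forall a u v, l (a *: u + v) = a * l u + l v) ->
  sesquilinear (fun u v => l u * Num.conj (l v)).
Proof.
move=> lP; split=> w a u v /=; rewrite lP; first by ring.
by rewrite rmorphD rmorphM/=; ring.
Qed.

Lemma sesqD s t : sesquilinear s -> sesquilinear t ->
  sesquilinear (fun u v => s u v + t u v).
Proof.
move=> [sl sr] [tl tr]; split=> w a u v /=.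
  by rewrite [s _ _](sl w a u v) [t _ _](tl w a u v); ring.
by rewrite [s _ _](sr w a u v) [t _ _](tr w a u v) /=; ring.
Qed.

Lemma sesqZ (c : R) s : sesquilinear s -> sesquilinear (fun u v => c%:C * s u v).
Proof.
move=> [sl sr]; split=> w a u v /=.
  by rewrite [s _ _](sl w a u v); ring.
by rewrite [s _ _](sr w a u v) /=; ring.
Qed.

Lemma sesqB s t : sesquilinear s -> sesquilinear t ->
  sesquilinear (fun u v => s u v - t u v).
Proof.
move=> ss /(@sesqZ (-1)) st; have := sesqD ss st.
congr sesquilinear; apply/funext => u; apply/funext => v.
by rewrite rmorphN1 mulN1r.
Qed.

Lemma lower_boundsP t (c : R) : lower_bounds t c <->
  forall u, t u u = (complex.Re (t u u))%:C /\
            c * rnorm (\val u) ^+ 2 <= complex.Re (t u u).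
Proof.
have E u : c%:C * `|\val u| ^+ 2 = (c * rnorm (\val u) ^+ 2)%:C.
  by rewrite rmorphM rmorphXn/= rnormE.
by split=> tc u; have := tc u; rewrite /= E => /complex_ge.
Qed.

Lemma sesq_val : sesquilinear (fun u v => hdot H (\val u) (\val v)).
Proof. exact: (@sesq_hdot H [the {linear lsubspace D -> H} of \val]). Qed.

End SesquilinearForms.

Lemma cvg_rnorm (R : realType) (V : normedModType R[i]) (f : nat -> V) (x : V) :
  (f n @[n --> \oo] --> x)%classic ->
  (rnorm (f n) @[n --> \oo] --> rnorm x)%classic.
Proof.
move=> /cvg_rnormP fx; apply/cvgrPdist_lt => e /fx[N NP].
by exists N => // n /= Nn; rewrite distrC (le_lt_trans (rnorm_dist _ _))// NP.
Qed.

Lemma cvg_rnorm0 (R : realType) (V : normedModType R[i]) (f : nat -> V) (g : nat -> R) :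
  (forall n, rnorm (f n) <= g n) ->
  (forall e : R, 0 < e -> exists N, forall n, (N <= n)%N -> g n < e) ->
  (f n @[n --> \oo] --> (0 : V))%classic.
Proof.
move=> fg g0; apply/cvg_rnormP => e /g0[N NP]; exists N => n /NP.
by rewrite subr0; exact: le_lt_trans.
Qed.

(** * Maximality of the regular form, and uniqueness when it is bounded *)

Section RegularForm.
Variables (R : realType) (H K : hilbertType R) (D : submodClosed H).
Variables (c : R) (Q : {linear lsubspace D -> K}).
Variable t : lsubspace D -> lsubspace D -> R[i].
Hypothesis tQ : represents c Q t.
Implicit Types (u v w : lsubspace D).

Lemma reg_formE u v : reg_form c Q u v =
  c%:C * hdot H (\val u) (\val v) + hdot K (reg_part Q u) (reg_part Q v).
Proof. by []. Qed.

Lemma reg_form_diag u : reg_form c Q u u =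
  (c * rnorm (\val u) ^+ 2 + rnorm (reg_part Q u) ^+ 2)%:C.
Proof. by rewrite reg_formE !hdotE -rmorphM -rmorphD. Qed.

Lemma sing_formE u v : sing_form Q u v = hdot K (sing_part Q u) (sing_part Q v).
Proof. by []. Qed.

Lemma form_diag u : t u u = (c * rnorm (\val u) ^+ 2 + rnorm (Q u) ^+ 2)%:C.
Proof. by rewrite tQ !hdotE -rmorphM -rmorphD. Qed.

Lemma lebesgue_sum u v : t u v = reg_form c Q u v + sing_form Q u v.
Proof. by rewrite tQ reg_formE sing_formE hdot_parts addrA. Qed.

Lemma sesq_reg_form : sesquilinear (reg_form c Q).
Proof. exact: sesqD (sesqZ c (sesq_val D)) (sesq_hdot (reg_part Q)). Qed.

Lemma sesq_sing_form : sesquilinear (sing_form Q).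
Proof. exact: sesq_hdot (sing_part Q). Qed.

(* If [w n --> 0] and [Q (w n)] tends to the singular part of [Q u], then
   closability gives [t1 (w n) (w n) --> 0], so [t1 u u] is controlled by
   [t (u - w n) (u - w n)], which tends to [reg_form c Q u u]. *)
Lemma reg_form_max t1 u : sesquilinear t1 -> semibounded t1 -> closable t1 ->
  (forall v, t1 v v <= t v v) -> t1 u u <= reg_form c Q u u.
Proof.
move=> s1 [c1 c1b] cl1 t1t; have c1P := (lower_boundsP _ _).1 c1b.
(* Shifting by a lower bound of [t1] gives a nonnegative form, to which Young's inequality
   applies. *)
pose s v w := t1 v w - c1%:C * hdot H (\val v) (\val w).
have ss : sesquilinear s by exact: sesqB s1 (sesqZ c1 (sesq_val D)).
have s0 v : 0 <= s v v.
  rewrite /s hdotE -rmorphM/=; have [-> ?] := c1P v.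
  by rewrite -rmorphB/= ler0c subr_ge0.
have sE v : complex.Re (s v v) = complex.Re (t1 v v) - c1 * rnorm (\val v) ^+ 2.
  by rewrite /s hdotE ReD ReN ReZ.
have t1le v : complex.Re (t1 v v) <= c * rnorm (\val v) ^+ 2 + rnorm (Q v) ^+ 2.
  by have := t1t v; rewrite form_diag lecE => /andP[].
have /choice[w wP] : forall n : nat, exists w, rnorm (\val w) < n.+1%:R^-1 /\
    rnorm (Q w - sing_part Q u) < n.+1%:R^-1.
  move=> n; have n0 : 0 < n.+1%:R^-1 :> R by rewrite invr_gt0.
  by have [w ? ?] := sing_part_approx Q u n0; exists w.
have w0 : (\val (w n) @[n --> \oo] --> (0 : H))%classic.
  apply: (@cvg_rnorm0 _ _ _ (fun n => n.+1%:R^-1)) => [n|]; last exact: eventually_invn_lt.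
  by apply: ltW; case: (wP n).
have Qw : (Q (w n) @[n --> \oo] --> sing_part Q u)%classic.
  apply/cvg_rnormP => e /eventually_invn_lt[N NP]; exists N => n /NP.
  by apply: lt_trans; case: (wP n).
have tw0 : ((t1 (w n) (w n) : R[i]^o) @[n --> \oo] --> (0 : R[i]^o))%classic.
  apply: cl1 => //; apply/cvg_rnorm2P => e e0 /=.
  (* [B] is the constant of [ltr_norm_between]. Two errors below [d] keep the norms of [v] and [Q v]
     below the square root of [e / B]. *)
  pose B := `|c1| + `|c| + 1.
  have B0 : 0 < B by rewrite /B; have := normr_ge0 c1; have := normr_ge0 c; lra.
  pose d := Num.sqrt (e / B) / 2.
  have d0 : 0 < d by rewrite divr_gt0// sqrtr_gt0 divr_gt0.
  have [N NP] := eventually_invn_lt d0; exists N => m n /NP Nm /NP Nn.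
  rewrite subr0; set v := w m - w n.
  have v1 : rnorm (\val v) ^+ 2 < e / B.
    rewrite -[e / B]sqr_sqrtr ?(ltW (divr_gt0 _ _))//.
    rewrite ltr_sqr ?nnegrE ?rnorm_ge0 ?sqrtr_ge0//.
    rewrite linearB/= (le_lt_trans (rnormB _ _))//.
    by have := lt_trans (wP m).1 Nm; have := lt_trans (wP n).1 Nn; rewrite /d; lra.
  have v2 : rnorm (Q v) ^+ 2 < e / B.
    rewrite -[e / B]sqr_sqrtr ?(ltW (divr_gt0 _ _))//.
    rewrite ltr_sqr ?nnegrE ?rnorm_ge0 ?sqrtr_ge0//.
    rewrite linearB/= (le_lt_trans (rnorm_triangle (sing_part Q u) _ _))//.
    rewrite (rnormC (sing_part _ _)).
    by have := lt_trans (wP m).2 Nm; have := lt_trans (wP n).2 Nn; rewrite /d; lra.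
  have [-> c1v] := c1P v; rewrite rnorm_real.
  have tv := t1le v.
  have eB : (`|c1| + `|c| + 1) * (e / B) = e by rewrite -/B mulrC divfK ?gt_eqF.
  rewrite -eB; apply: (@ltr_norm_between _ _ _ _ _ _ _ (sqr_ge0 _) v1 v2 c1v tv).
have [-> _] := c1P u; rewrite reg_form_diag lecR.
(* [L] is the target value shifted by [c1], as in [s]. *)
pose L := (c - c1) * rnorm (\val u) ^+ 2 + rnorm (reg_part Q u) ^+ 2.
suff : complex.Re (s u u) <= L by rewrite sE /L; lra.
have key (e : R) : 0 < e -> complex.Re (s u u) <= (1 + e) * L.
  move=> e0.
  (* The added zero is written as the limit of the second summand of [f]. *)
  have -> : (1 + e) * L = (1 + e) * L + (1 + e^-1) * (0 - c1 * rnorm (0 : H) ^+ 2).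
    by rewrite rnorm0 expr0n/= mulr0 subr0 mulr0 addr0.
  (* Young's bound for [u = (u - w n) + w n]: the first term is estimated through [t], the second
     through [t1 (w n) (w n)], which tends to 0. *)
  pose f n := (1 + e) * ((c - c1) * rnorm (\val (u - w n)) ^+ 2 + rnorm (Q (u - w n)) ^+ 2)
     + (1 + e^-1) * (rnorm (t1 (w n) (w n) : R[i]^o) - c1 * rnorm (\val (w n)) ^+ 2).
  apply: (@ler_cvg_to _ \oo%classic _ _ (fun=> complex.Re (s u u)) f).
  - exact: cvg_cst.
  - have cx : (rnorm (\val (u - w n)) @[n --> \oo] --> rnorm (\val u))%classic.
      have -> : rnorm (\val u) = rnorm (\val u - 0 : H) by rewrite subr0.
      apply: cvg_rnorm; under eq_fun do rewrite linearB/=.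
      by apply: cvgB => //; exact: cvg_cst.
    have cy : (rnorm (Q (u - w n)) @[n --> \oo] --> rnorm (reg_part Q u))%classic.
      apply: cvg_rnorm; under eq_fun do rewrite linearB/=.
      by apply: cvgB => //; exact: cvg_cst.
    have ct := cvg_rnorm tw0; rewrite rnorm0 in ct.
    have cw := cvg_rnorm w0.
    rewrite /f /L; apply: cvgD; apply: cvgMr.
      apply: cvgD; [apply: cvgMr|];
        by rewrite expr2; under eq_fun do rewrite expr2; apply: cvgM.
    apply: cvgB => //; apply: cvgMr.
    by rewrite expr2; under eq_fun do rewrite expr2; apply: cvgM.
  - near=> n.
    rewrite -{1 2}(subrK (w n) u) /f; apply: le_trans (sesq_young _ _ ss s0 e0) _.
    rewrite lerD// ler_pM2l ?addr_gt0 ?invr_gt0// sE.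
      by have := t1le (u - w n); lra.
    by rewrite lerD2r; apply: le_trans (ler_norm _) (ler_Re_rnorm _).
clearbody L; have L0 : 0 <= L.
  have := key 1 ltr01; have := Re_ge0 (s0 u); lra.
(* The parameter [e / (L + 1)] raises [L] by at most [e], and its denominator is positive even for
   [L = 0]. *)
apply/ler_addgt0Pr => e e0; have L1 : 0 < L + 1 by lra.
have := key (e / (L + 1)) (divr_gt0 e0 L1).
have : e / (L + 1) * L <= e.
  by rewrite mulrAC ler_pdivrMr// ler_pM2l//; lra.
by lra.
Unshelve. all: by end_near.
Qed.

Lemma bounded_reg_form_unique t1 t2 : form_bounded (reg_form c Q) ->
  lebesgue_type_decomposition t t1 t2 -> t1 = reg_form c Q /\ t2 = sing_form Q.
Proof.
move=> [a a0 regb] [s1 s2 tE [sb1 cl1] [nn2 sg2]].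
pose s u v := reg_form c Q u v - t1 u v.
have ss : sesquilinear s by exact: sesqB sesq_reg_form s1.
have sge0 u : 0 <= s u u.
  rewrite subr_ge0; apply: reg_form_max => // v.
  by rewrite tE lerDl.
have sE u v : t2 u v = s u v + sing_form Q u v.
  have := tE u v; rewrite lebesgue_sum /s => E.
  by apply: (addrI (t1 u v)); rewrite -E; ring.
have sle2 u : complex.Re (s u u) <= complex.Re (t2 u u).
  by rewrite sE (ReD (s u u)) sing_formE hdotE lerDl sqr_ge0.
have [c1 c1b] := sb1; have c1P := (lower_boundsP _ _).1 c1b.
(* The constant [a] bounds [reg_form] and [c1] bounds [t1] from below. *)
have sbd u : complex.Re (s u u) <= (a + `|c1|) * rnorm (\val u) ^+ 2.
  have := regb u; rewrite -!rnormE -rmorphXn -rmorphM lecR => rb.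
  have := le_trans (le_trans (ler_norm _) (ler_Re_rnorm _)) rb.
  have [_ c1u] := c1P u; rewrite /s ReD ReN.
  have := ler_norm (- c1); rewrite normrN => c1c.
  have := ler_wpM2r (sqr_ge0 (rnorm (\val u))) c1c.
  by move: c1u; lra.
have s0 u : s u u = 0.
  rewrite (ge0_ReE (sge0 u)); congr (_%:C); apply/eqP.
  rewrite eq_le (Re_ge0 (sge0 u)) andbT; apply/ler_addgt0Pr => e e0; rewrite add0r.
  (* Split [u] as [un n + (u - un n)]: [s] is small on the first term because it lies below [t2], on
     the second because it is bounded. Young's inequality with parameter 1 doubles both, whence the
     tolerances [e / 4]. *)
  have [un [/cvg_rnormP unu /cvg_rnormP t2n]] := sg2 u.
  pose B := a + `|c1| + 1.
  have B0 : 0 < B by rewrite /B; have := normr_ge0 c1; lra.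
  have d0 : 0 < Num.sqrt (e / 4 / B) by rewrite sqrtr_gt0 !divr_gt0.
  have e40 : 0 < e / 4 by rewrite divr_gt0.
  have [N1 N1P] := unu _ d0; have [N2 N2P] := t2n _ e40.
  pose n := maxn N1 N2.
  have := N1P n (leq_maxl _ _); have := N2P n (leq_maxr _ _).
  rewrite subr0 => t2lt ult.
  have := sesq_young (un n) (u - un n) ss sge0 (@ltr01 R); rewrite addrC subrK.
  have := sbd (u - un n); have := sle2 (un n).
  have := le_trans (ler_norm _) (ler_Re_rnorm (t2 (un n) (un n))).
  have : rnorm (\val (u - un n)) ^+ 2 <= e / 4 / B.
    rewrite -[leRHS]sqr_sqrtr ?(ltW (divr_gt0 _ _))//.
    by rewrite ler_sqr ?nnegrE ?rnorm_ge0 ?sqrtr_ge0// linearB/= rnormC ltW.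
  rewrite ler_pdivlMr// invr1; have := sqr_ge0 (rnorm (\val (u - un n))).
  rewrite /B; lra.
have st1 : t1 = reg_form c Q.
  apply/funext => u; apply/funext => v; apply/esym/eqP; rewrite -subr_eq0.
  by rewrite -/(s u v) (sesq_diag0 ss s0).
split=> //; apply/funext => u; apply/funext => v.
by rewrite sE (sesq_diag0 ss s0) add0r.
Qed.

End RegularForm.

(** * Lebesgue type decompositions *)

(** For [x] below 1 the square is at most [x]; dividing by [C + 1] covers [C = 0]. *)
Lemma mul_sqr_lt (F : realFieldType) (C e : F) : 0 <= C -> 0 < e ->
  exists2 d, 0 < d & forall x, 0 <= x -> x < d -> C * x ^+ 2 < e.
Proof.
move=> C0 e0; have C1 : 0 < C + 1 by lra.
exists (Num.min 1 (e / (C + 1))) => [|x x0]; first by rewrite lt_min ltr01 divr_gt0.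
rewrite lt_min ltr_pdivlMr// => /andP[x1 xe].
apply: le_lt_trans xe; rewrite expr2 mulrA.
have : C * x * x <= C * x * 1 by rewrite ler_wpM2l ?mulr_ge0// ltW.
by lra.
Qed.

Section Decompositions.
Variables (R : realType) (H K : hilbertType R) (D : submodClosed H).
Variables (c : R) (Q : {linear lsubspace D -> K}).
Implicit Types (u v w : lsubspace D).

(** The bounds make [N] comparable with the square of the closable operator [A], so closability
    passes to the form. It serves both [reg_form] and its perturbation by a functional. *)
Lemma closable_reg_part (t : lsubspace D -> lsubspace D -> R[i])
    (N : lsubspace D -> R) :
  (forall u, t u u = (c * rnorm (\val u) ^+ 2 + N u)%:C) ->
  (forall u, rnorm (reg_part Q u) ^+ 2 <= 2 * N u) ->
  (forall u, N u <= rnorm (reg_part Q u) ^+ 2) -> closable t.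
Proof.
move=> tE AN NA u /cvg_rnormP u0 /cvg_rnorm2P t0.
have u0' (e : R) : 0 < e -> exists M, forall n, (M <= n)%N -> rnorm (\val (u n)) < e.
  by move=> /u0[M MP]; exists M => n /MP; rewrite subr0.
have [k Ak] : exists k, forall e : R, 0 < e -> exists M, forall n, (M <= n)%N ->
    rnorm (reg_part Q (u n) - k) < e.
  apply: cauchy_rnormP => e e0.
  (* The form and the term with [c] each contribute less than [e ^+ 2 / 4] to [N], and passing from
     [N] to [A] doubles the sum. *)
  have e40 : 0 < e ^+ 2 / 4 by rewrite divr_gt0// exprn_gt0.
  have [d d0 dP] := mul_sqr_lt (normr_ge0 c) e40.
  have d20 : 0 < d / 2 by rewrite divr_gt0.
  have [M1 M1P] := u0' _ d20; have [M2 M2P] := t0 _ e40.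
  exists (maxn M1 M2) => m n; rewrite !geq_max => /andP[/M1P m1 m2] /andP[/M1P n1 n2].
  have := M2P _ _ m2 n2; rewrite subr0 tE/= rnorm_real => tlt.
  have vlt : rnorm (\val (u m - u n)) < d.
    by rewrite linearB/= (le_lt_trans (rnormB _ _))//; lra.
  rewrite -ltr_sqr ?nnegrE ?rnorm_ge0 ?(ltW e0)// -(linearB (reg_part Q)).
  have := dP _ (rnorm_ge0 _) vlt.
  have := AN (u m - u n); move: tlt; rewrite ltr_norml => /andP[_ tlt].
  have := ler_wpM2r (sqr_ge0 (rnorm (\val (u m - u n)))) (ler_norm (- c)).
  rewrite normrN; lra.
have k0 := reg_part_closable u0' Ak.
apply/cvg_rnormP => e e0; have e20 : 0 < e / 2 by rewrite divr_gt0.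
have [d1 d10 d1P] := mul_sqr_lt (normr_ge0 c) e20.
have [d2 d20 d2P] := mul_sqr_lt ler01 e20.
have [M1 M1P] := u0' _ d10; have [M2 M2P] := Ak _ d20.
exists (maxn M1 M2) => n; rewrite geq_max => /andP[/M1P n1 /M2P].
rewrite k0 !subr0 tE rnorm_real => n2.
have := d1P _ (rnorm_ge0 _) n1; have := d2P _ (rnorm_ge0 _) n2; rewrite mul1r => a1 a2.
have N0 : 0 <= N (u n).
  by have := AN (u n); have := sqr_ge0 (rnorm (reg_part Q (u n))); lra.
apply: le_lt_trans (ler_normD _ _) _; rewrite normrM (ger0_norm (sqr_ge0 _)) (ger0_norm N0).
by have := NA (u n); lra.
Qed.

Lemma singularP (t : lsubspace D -> lsubspace D -> R[i]) :
  (forall u (e : R), 0 < e ->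
    exists2 w, rnorm (\val w) < e & rnorm (t (u - w) (u - w)) < e) -> singular t.
Proof.
move=> tP u.
have /choice[w wP] : forall n : nat, exists w, rnorm (\val w) < n.+1%:R^-1 /\
    rnorm (t (u - w) (u - w)) < n.+1%:R^-1.
  move=> n; have n0 : 0 < n.+1%:R^-1 :> R by rewrite invr_gt0.
  by have [w ? ?] := tP u _ n0; exists w.
exists (fun n => u - w n); split; apply/cvg_rnormP => e /eventually_invn_lt[M MP];
  exists M => n /MP; apply: lt_trans.
  by rewrite linearB/= addrAC subrr add0r rnormN; case: (wP n).
by rewrite subr0; case: (wP n).
Qed.

Lemma lebesgue_decompositionP t : represents c Q t ->
  lebesgue_type_decomposition t (reg_form c Q) (sing_form Q).
Proof.
move=> tQ; split.
- exact: sesq_reg_form.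
- exact: sesq_sing_form.
- exact: lebesgue_sum.
- split.
    exists c; apply/lower_boundsP => u; rewrite reg_form_diag; split=> //=.
    by rewrite lerDl sqr_ge0.
  apply: closable_reg_part (reg_form_diag c Q) _ _ => // u.
  by have := sqr_ge0 (rnorm (reg_part Q u)); lra.
- split; first by move=> u; rewrite sing_formE hdotE ler0c sqr_ge0.
  apply: singularP => u e e0.
  have [d d0 dP] := mul_sqr_lt ler01 e0.
  (* Subtracting [w] nearly cancels the singular part of [u] while moving [u] by less than [e]. *)
  have [|w] := @sing_part_approx _ _ _ _ Q u (Num.min d e); first by rewrite lt_min d0.
  rewrite !lt_min => /andP[_ w1] /andP[w2 _]; exists w => //.
  rewrite sing_formE hdotE rnorm_real ger0_norm ?sqr_ge0// -[ltLHS]mul1r.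
  apply: dP; rewrite ?rnorm_ge0//; apply: le_lt_trans w2.
  by rewrite linearB/= rnormC; exact: sing_part_dist.
Qed.

Lemma reg_part_bounded_form (C : R) :
  (forall u, rnorm (reg_part Q u) <= C * rnorm (\val u)) ->
  form_bounded (reg_form c Q).
Proof.
move=> AC; exists (`|c| + C ^+ 2) => [|u]; first by rewrite addr_ge0 ?sqr_ge0.
rewrite -!rnormE -rmorphXn -rmorphM lecR reg_form_diag rnorm_real.
apply: le_trans (ler_normD _ _) _; rewrite normrM !(ger0_norm (sqr_ge0 _)) mulrDl lerD2l.
rewrite -exprMn ler_sqr ?nnegrE ?rnorm_ge0//.
by apply: le_trans (AC u); exact: rnorm_ge0.
Qed.

(** Unit vectors with rapidly growing images feed the gliding hump. Scaling [k] makes it short, and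
    dividing the unit vectors by their growing pairings gives small vectors with pairing 1. *)
Lemma reg_part_unbounded_functional : ~ form_bounded (reg_form c Q) ->
  exists2 k, rnorm k <= 2^-1 & forall e : R, 0 < e ->
    exists2 v, rnorm (\val v) < e & hdot K (reg_part Q v) k = 1.
Proof.
move=> unb.
have /choice[x xP] : forall n : nat, exists u, rnorm (\val u) = 1 /\
    2 * n%:R * 3 ^+ n <= rnorm (reg_part Q u).
  move=> n; apply: contrapT => nex; apply: unb.
  apply: (@reg_part_bounded_form (2 * n%:R * 3 ^+ n)) => u.
  have [u0|u0] := eqVneq (rnorm (\val u)) 0.
    have -> : u = 0 by apply: val_inj; exact: rnorm_eq0.
    by rewrite !linear0 !rnorm0 mulr0.
  have u0' : 0 < rnorm (\val u) by rewrite lt_neqAle eq_sym u0 rnorm_ge0.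
  rewrite leNgt -ltr_pdivlMr//; apply/negP => ltu; apply: nex.
  exists ((rnorm (\val u))^-1%:C *: u); rewrite !linearZ/= !rnormZ rnorm_real.
  rewrite ger0_norm ?invr_ge0 ?rnorm_ge0// mulVf//; split => //.
  by rewrite [leRHS]mulrC ltW.
have [k kP] := exists_dot_unbounded (fun n => (xP n).2).
have K0 : 0 < 2 * (1 + rnorm k) by have := rnorm_ge0 k; lra.
pose a := (2 * (1 + rnorm k))^-1; have a0 : 0 < a by rewrite invr_gt0.
exists (a%:C *: k).
  rewrite rnormZ rnorm_real gtr0_norm// mulrC ler_pdivrMr//.
  by have := rnorm_ge0 k; lra.
(* The pairing [h] is at least [a * N.+1%:R], so its inverse is below [e]; the index [N.+1] keeps
   [h] nonzero even for [N = 0]. *)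
move=> e e0; have [N NP] := eventually_invn_lt (mulr_gt0 e0 a0).
have := NP _ (leqnn N); pose h := hdot K (reg_part Q (x N.+1)) (a%:C *: k).
have hE : rnorm h = a * rnorm (hdot K (reg_part Q (x N.+1)) k).
  by rewrite /h hdotZr conj_real rnormM rnorm_real gtr0_norm.
have hN : a * N.+1%:R <= rnorm h by rewrite hE ler_pM2l.
have h0 : 0 < rnorm h by apply: lt_le_trans hN; rewrite mulr_gt0.
have h0' : h != 0 by apply: contraTneq h0 => ->; rewrite rnorm0 ltxx.
move=> Ne; exists (h^-1 *: x N.+1); last first.
  have -> : reg_part Q (h^-1 *: x N.+1) = h^-1 *: reg_part Q (x N.+1).
    by rewrite linearZ.
  by rewrite hdotZl -/h mulVf.
rewrite linearZ/= rnormZ rnormV (xP _).1 mulr1 invf_plt ?posrE//.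
apply: lt_le_trans hN; rewrite -(ltr_pM2l e0) mulfV ?gt_eqF// mulrA.
by move: Ne; rewrite -[_^-1]mul1r ltr_pdivrMr.
Qed.

Lemma not_unique_decomposition t : represents c Q t ->
  ~ form_bounded (reg_form c Q) ->
  exists t1 t2, lebesgue_type_decomposition t t1 t2 /\ t1 <> reg_form c Q.
Proof.
move=> tQ /reg_part_unbounded_functional[k k1 kv].
pose l u := hdot K (reg_part Q u) k.
have lP a u v : l (a *: u + v) = a * l u + l v.
  by rewrite /l linearP/= hdotDl hdotZl.
have lB u v : l (u - v) = l u - l v.
  by rewrite -[u - v]addrC -scaleN1r lP mulN1r addrC.
have lle u : rnorm (l u) <= rnorm (reg_part Q u) / 2.
  by apply: le_trans (cauchy_schwarz _ _) _; rewrite ler_wpM2l ?rnorm_ge0.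
have ldiag u : l u * Num.conj (l u) = (rnorm (l u) ^+ 2)%:C by exact: mulr_conjE.
(* The bound on [k] enters here: subtracting the square of [l] leaves at least three quarters of the
   square of [A]. *)
have lle2 u : rnorm (l u) ^+ 2 <= rnorm (reg_part Q u) ^+ 2 / 4.
  have -> : rnorm (reg_part Q u) ^+ 2 / 4 = (rnorm (reg_part Q u) / 2) ^+ 2 by field.
  by rewrite ler_sqr ?nnegrE ?divr_ge0 ?rnorm_ge0.
pose t1 u v := reg_form c Q u v - l u * Num.conj (l v).
pose t2 u v := sing_form Q u v + l u * Num.conj (l v).
have t1E u : t1 u u =
    (c * rnorm (\val u) ^+ 2 + (rnorm (reg_part Q u) ^+ 2 - rnorm (l u) ^+ 2))%:C.
  by rewrite /t1 ldiag reg_form_diag -rmorphB/= addrA.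
have t2E u : t2 u u = (rnorm (sing_part Q u) ^+ 2 + rnorm (l u) ^+ 2)%:C.
  by rewrite /t2 ldiag sing_formE hdotE -rmorphD.
exists t1, t2; split; last first.
  have [v _ lv] := kv _ ltr01; move=> /(congr1 (fun f => f v v)) /eqP.
  rewrite /t1 -subr_eq0 addrAC subrr add0r oppr_eq0 [l v]lv mul1r rmorph1.
  by rewrite oner_eq0.
split.
- exact: sesqB (sesq_reg_form _ _) (sesq_rank1 lP).
- exact: sesqD (sesq_sing_form _) (sesq_rank1 lP).
- by move=> u v; rewrite (lebesgue_sum tQ) /t1 /t2; ring.
- split.
    exists c; apply/lower_boundsP => u; rewrite t1E; split=> //=.
    by have := lle2 u; have := sqr_ge0 (rnorm (reg_part Q u)); lra.
  apply: closable_reg_part t1E _ _ => u.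
    by have := lle2 u; have := sqr_ge0 (rnorm (reg_part Q u)); lra.
  by rewrite gerBl sqr_ge0.
- split; first by move=> u; rewrite t2E ler0c addr_ge0 ?sqr_ge0.
  apply: singularP => u e e0; pose g := l u; pose G := rnorm g + 1.
  have g0 := rnorm_ge0 g; have G0 : 0 < G by rewrite /G; lra.
  have e20 : 0 < e / 2 by rewrite divr_gt0.
  have [d d0 dP] := mul_sqr_lt ler01 e20.
  (* The errors add up to at most [2 * G * f], which is the minimum of [d] and [e]. *)
  pose f := Num.min d e / (2 * G).
  have m0 : 0 < Num.min d e by rewrite lt_min d0.
  have f0 : 0 < f by rewrite divr_gt0// mulr_gt0.
  have fE : 2 * G * f = Num.min d e by rewrite mulrC divfK// gt_eqF// mulr_gt0.
  have [w1 w1a w1b] := sing_part_approx Q u f0.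
  have [v va lv] := kv _ f0.
  have [w2 w2a w2b] := sing_part_approx Q v f0.
  (* When [Q w] is near the multivalued part, the regular part of [w] is small, and so is [l w]. *)
  have lsmall w y : rnorm (Q w - sing_part Q y) < f -> rnorm (l w) < f.
    move=> wf; have := lle w; have := reg_part_dist Q w y.
    by have := rnorm_ge0 (reg_part Q w); lra.
  have ssmall w y : rnorm (Q w - sing_part Q y) < f ->
      rnorm (sing_part Q y - sing_part Q w) < f.
    by move=> wf; rewrite rnormC (le_lt_trans (sing_part_dist _ _ _) wf).
  (* [w1] moves the singular part of [u] to [0], [v - w2] then corrects [l]
     at almost no cost in the singular part. *)
  pose w := w1 + g *: (v - w2).
  have gmul x : x < f -> rnorm g * x <= rnorm g * f by move=> /ltW; exact: ler_wpM2l.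
  have uwE : u - w = (u - w1) - g *: (v - w2) by rewrite /w opprD addrA.
  have lf := lsmall _ _ w1b; have lf2 := gmul _ (lsmall _ _ w2b).
  have sf := ssmall _ _ w1b; have sf2 := gmul _ (ssmall _ _ w2b).
  have vf := gmul _ va; have wf := gmul _ w2a.
  have fG : (rnorm g + 1) * f * 2 = Num.min d e by rewrite -fE /G; ring.
  have me : Num.min d e <= e by rewrite ge_min lexx orbT.
  have md : Num.min d e <= d by rewrite ge_min lexx.
  exists w.
    rewrite /w linearD linearZ linearB/=.
    apply: le_lt_trans (rnormD _ _) _; rewrite rnormZ.
    have := ler_wpM2l g0 (rnormB (\val v) (\val w2)); lra.
  have s1 : rnorm (sing_part Q (u - w)) < d.
    rewrite uwE linearB (linearB _ u) linearZ (linearB _ v)/=.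
    apply: le_lt_trans (rnormB _ _) _; rewrite rnormZ; lra.
  have s2 : rnorm (l (u - w)) < d.
    (* The main term [g] cancels because [l v = 1]; only the two small corrections remain. *)
    have -> : l (u - w) = g * l w2 - l w1.
      rewrite lB /w [w1 + _]addrC lP lB [l v]lv -/g; ring.
    by apply: le_lt_trans (rnormB _ _) _; rewrite rnormM; lra.
  rewrite t2E rnorm_real ger0_norm ?addr_ge0 ?sqr_ge0//.
  have := dP _ (rnorm_ge0 _) s1; have := dP _ (rnorm_ge0 _) s2; lra.
Qed.

End Decompositions.

Theorem theorem5p5 (R : realType) (H : hilbertType R) (D : submodClosed H)
    (D_neq0 : exists u : lsubspace D, u != 0)
    (t : lsubspace D -> lsubspace D -> R[i])
    (t_sesq : sesquilinear t) (t_semi : semibounded t)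
    (K : hilbertType R) (c : R) (Q : {linear lsubspace D -> K})
    (c_le : c <= lower_bound t) (tQ : represents c Q t) :
  (lebesgue_type_decomposition t (reg_form c Q) (sing_form Q) /\
   forall t1 t2 : lsubspace D -> lsubspace D -> R[i],
     lebesgue_type_decomposition t t1 t2 ->
     t1 = reg_form c Q /\ t2 = sing_form Q)
  <-> form_bounded (reg_form c Q).
Proof.
split=> [[_ uniq]|bd].
  apply: contrapT => /(not_unique_decomposition tQ)[t1 [t2 [/uniq[-> _]]]].
  exact.
split; first exact: lebesgue_decompositionP.
by move=> t1 t2; exact: bounded_reg_form_unique.
Qed.
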